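(* Let $n\geqslant 2$ be an integer and let $\alpha\in(0,2]$, $\alpha<n$. For any $\xi\in\mathfrak{M}$ with $\xi^+(\mathbb{R}^n)\ne\xi^-(\mathbb{R}^n)$, the set of all $x\in\mathbb{R}^n$ for which $\kappa_\alpha\xi(x)=0$ is inner $\alpha$-thin at infinity.
   Context: Kernel and potential: $\kappa_\alpha(x,y):=|x-y|^{\alpha-n}$ is the $\alpha$-Riesz kernel on $\mathbb{R}^n$ ($|x-y|$ the Euclidean distance, $\kappa_\alpha(x,x)=+\infty$). For a positive Radon measure $\mu$ on $\mathbb{R}^n$, $\kappa_\alpha\mu(x):=\int\kappa_\alpha(x,y)\,d\mu(y)\in[0,+\infty]$. $\mathfrak{M}^+$ is the cone of all positive Radon measures $\mu$ on $\mathbb{R}^n$ (possibly with $\mu(\mathbb{R}^n)=+\infty$) such that $\kappa_\alpha\mu$ is not identically $+\infty$; equivalently, $\int_{|y|>1}|y|^{\alpha-n}\,d\mu(y)<\infty$. Signed measures: $\mathfrak{M}$ is the linear space of all real-valued (signed) Radon measures $\xi$ on $\mathbb{R}^n$ such that $\int_{|y|>1}|y|^{\alpha-n}\,d|\xi|(y)<\infty$, where $|\xi|:=\xi^++\xi^-$ and $\xi^+,\xi^-$ are the positive and negative parts of $\xi$ in the Hahn–Jordan decomposition; the masses $\xi^\pm(\mathbb{R}^n)$ lie in $[0,+\infty]$. The potential is $\kappa_\alpha\xi:=\kappa_\alpha\xi^+-\kappa_\alpha\xi^-$; it is well defined and finite nearly everywhere on $\mathbb{R}^n$. Inner capacity: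 a measure $\mu\in\mathfrak{M}^+$ is concentrated on $A\subset\mathbb{R}^n$ if $A^c:=\mathbb{R}^n\setminus A$ is $\mu$-negligible. Let $\mathcal{E}^+_A$ be the set of all $\mu\in\mathfrak{M}^+$ concentrated on $A$ with finite energy $\kappa_\alpha(\mu,\mu):=\int\kappa_\alpha(x,y)\,d(\mu\otimes\mu)(x,y)<\infty$. The inner $\alpha$-Riesz capacity of an arbitrary $A\subset\mathbb{R}^n$ is $c_\alpha(A):=1/\inf\kappa_\alpha(\mu,\mu)$, the infimum being over all $\mu\in\mathcal{E}^+_A$ with $\mu(\mathbb{R}^n)=1$, with the conventions $\inf\varnothing=+\infty$, $1/(+\infty)=0$, $1/0=+\infty$. A property holds nearly everywhere (n.e.) on $A$ if the set $E$ of all $x\in A$ where it fails satisfies $c_\alpha(E)=0$. Inner $\alpha$-thinness at infinity: $A\subset\mathbb{R}^n$ is inner $\alpha$-thin at infinity if for some (equivalently, every) $y\in\mathbb{R}^n$, $$\sum_{j\in\mathbb{N}}\frac{c_\alpha(A_j)}{q^{j(n-\alpha)}}<\infty,\qquad\text{where } q\in(1,\infty)\text{ and }A_j:=A\cap\{x\in\mathbb{R}^n: q^j\leqslant|x-y|<q^{j+1}\}.$$ Equivalently, there exist $\nu\in\mathfrak{M}^+$ and a constant $c>0$ with $\kappa_\alpha\nu\geqslant c$ n.e. on $A$. *)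

(* Defs.v *)
From HB Require Import structures.
From mathcomp Require Import all_boot all_order all_algebra.
From mathcomp Require Import all_classical all_reals all_analysis.
Import Order.TTheory GRing.Theory Num.Theory.
Import numFieldNormedType.Exports.

Set Implicit Arguments.
Unset Strict Implicit.
Unset Printing Implicit Defensive.

Local Open Scope classical_set_scope.
Local Open Scope ring_scope.
Local Open Scope ereal_scope.

(* R^n with its Borel sigma-algebra; convertible to 'rV[R]_n. *)
Notation borel R n := (g_sigma_algebraType (@open 'rV[R]_n)).

Section riesz.
Context {R : realType} {n : nat}.
Implicit Types (x y : 'rV[R]_n) (A : set 'rV[R]_n).
Implicit Types (mu nu : {measure set (borel R n) -> \bar R}).

(* The library norm on 'rV[R]_n is the sup norm, hence this definition. *)
Definition euclidean_norm x : R :=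
  Num.sqrt (\sum_(i < n) (x ord0 i) ^+ 2)%R.

Definition edist x y : R := euclidean_norm (x - y)%R.

Definition riesz_kernel (alpha : R) x y : \bar R :=
  if x == y then +oo else (edist x y `^ (alpha - n%:R))%:E.

(* On R^n, a Borel measure is Radon as soon as it is finite on compact sets. *)
Definition radon mu : Prop :=
  forall K : set 'rV[R]_n, compact K -> mu K < +oo.

Definition potential (alpha : R) mu x : \bar R :=
  \int[mu]_(y in setT) riesz_kernel alpha x y.

Definition in_Mplus (alpha : R) mu : Prop :=
  radon mu /\ exists x, potential alpha mu x <> +oo.

Definition energy (alpha : R) mu : \bar R :=
  \int[mu \x mu]_(z in setT) riesz_kernel alpha z.1 z.2.

Definition concentrated mu A : Prop := mu.-negligible (~` A).

Definition in_Eplus (alpha : R) A mu : Prop :=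
  [/\ in_Mplus alpha mu, concentrated mu A & energy alpha mu < +oo].

(* In \bar R: ereal_inf set0 = +oo, (+oo)^-1 = 0 and 0^-1 = +oo. *)
Definition inner_capacity (alpha : R) A : \bar R :=
  (ereal_inf [set energy alpha mu | mu in
     [set mu : {measure set (borel R n) -> \bar R} |
       in_Eplus alpha A mu /\ mu setT = 1]])^-1.

Definition annulus (q : R) y (j : nat) : set 'rV[R]_n :=
  [set x | (q ^+ j <= edist x y < q ^+ j.+1)%R].

Definition inner_thin_at_infinity (alpha : R) A : Prop :=
  exists y, forall q : R, (1 < q)%R ->
    \sum_(0 <= j <oo)
      inner_capacity alpha (A `&` annulus q y j)
        / (q `^ (j%:R * (n%:R - alpha)))%:E < +oo.

(* A real-valued Radon measure need not extend to all Borel sets (both of its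
   parts may have infinite mass), so it is a countably additive real function
   of the relatively compact Borel sets; other values are irrelevant. *)
Record signed_radon := SignedRadon {
  signed_radon_val :> set (borel R n) -> R ;
  signed_radon_sigma_additive : forall F : nat -> set (borel R n),
    (forall i, measurable (F i)) -> trivIset setT F ->
    precompact ((\bigcup_i F i) : set 'rV[R]_n) ->
    (fun k => (\sum_(0 <= i < k) signed_radon_val (F i))%R) @ \oo -->
      signed_radon_val (\bigcup_i F i) }.

Definition mutually_singular mu nu : Prop :=
  exists2 P : set (borel R n), measurable P & mu (~` P) = 0 /\ nu P = 0.

Definition hahn_jordan (xi : signed_radon)
    (xip xim : {measure set (borel R n) -> \bar R}) : Prop :=
  [/\ radon xip, radon xim, mutually_singular xip xim &
      forall B : set (borel R n), measurable B ->
        precompact (B : set 'rV[R]_n) -> (xi B)%:E = xip B - xim B].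

(* Membership in the space M for the signed measure with positive and negative
   parts xip, xim; its total variation is xip + xim. *)
Definition in_M (alpha : R) (xip xim : {measure set (borel R n) -> \bar R})
    : Prop :=
  \int[measure_add xip xim]_(y in [set y | (1 < euclidean_norm y)%R])
    (euclidean_norm y `^ (alpha - n%:R))%:E < +oo.

(* In \bar R, +oo - +oo = -oo: where both potentials are infinite this
   difference, left undefined on paper, is -oo and in particular nonzero. *)
Definition signed_potential (alpha : R)
    (xip xim : {measure set (borel R n) -> \bar R}) x : \bar R :=
  potential alpha xip x - potential alpha xim x.

End riesz.

Arguments signed_radon : clear implicits.

(* Main.v *)
From Pilot Require Import Defs.
From HB Require Import structures.
From mathcomp Require Import all_boot all_order all_algebra.
From mathcomp Require Import all_classical all_reals all_analysis.
From mathcomp Require Import measurable_realfun ring lra.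
Import Order.TTheory GRing.Theory Num.Theory.
Import numFieldNormedType.Exports.
(* Makes [edist] the Euclidean distance again, rather than the extended
   distance of pseudometric spaces. *)
Import Pilot.Defs.

Local Open Scope classical_set_scope.
Local Open Scope ring_scope.

(** Let mu be the part of xi of larger mass, nu the other one, p := n - alpha,
    and let A be the set where the two potentials are finite and agree. Far
    away from the origin, mu acts like a point mass which is too big for nu to
    imitate: a large ball already carries a mu-mass m' > m := nu(R^n), so that
    at a distant x the potential of mu is at least
    m' ((1 + eps) |x|)^(-p). On the other hand the points y with |y| <= eps |x|
    or |y| >= 2 |x| all satisfy |x - y| >= (1 - eps) |x|, and therefore
    contribute at most m ((1 - eps) |x|)^(-p) to the potential of nu at x. If
    eps is small enough, the gap between the two bounds is delta |x|^(-p) with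
    delta > 0; hence, if j is large, at the points of A in the annulus
    q^j <= |x| < q^(j+1) the restriction nu_j of nu to the shell
    L_j = { eps q^j < |y| <= eps q^(j+l) } has a potential of at least
    delta q^(-(j+1)p) (lemma [local_potential_ge]).

    A set on which a measure nu has potential at least c > 0 has capacity at
    most C nu(R^n) / c (lemma [inner_capacity_le]). Hence the j-th term of the
    series defining thinness is at most a constant times nu(L_j). The shells
    overlap at most l times and nu is finite, so the series converges
    (lemma [thin_at_infinity_of_mass_lt]).

    The capacity bound is obtained without equilibrium measures. Let mu be a
    probability measure on the set, of energy at most t. At least half of its
    mass lies on F = { potential of mu <= 2 t } by Markov's inequality, and by a weak form
    of the maximum principle, with the constant 3^p (lemma
    [weak_maximum_principle]), the potential of mu restricted to F is at most
    2 * 3^p * t everywhere. Integrating the potential of nu against this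
    restriction, and exchanging the integrals, gives
    c / 2 <= 2 * 3^p * t * nu(R^n). *)

(** * Real numbers *)

Section real_lemmas.
Context {R : realType}.

Lemma le_powR_neg (e a b : R) : e < 0 -> 0 < a -> a <= b -> b `^ e <= a `^ e.
Proof.
move=> e0 a0 ab; have b0 := lt_le_trans a0 ab.
rewrite -[e]opprK !(powRN _ (- e)) lef_pV2 ?posrE ?powR_gt0//.
by apply: ge0_ler_powR => //; rewrite ?nnegrE ?oppr_ge0 ltW.
Qed.

Lemma exprn_unbounded (q M : R) : 1 < q ->
  exists k, forall j, (k <= j)%N -> M <= q ^+ j.
Proof.
move=> q1.
have bern k : 1 + k%:R * (q - 1) <= q ^+ k.
  elim: k => [|k IH]; first by rewrite mul0r addr0 expr0.
  rewrite exprS -natr1.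
  have : q * (1 + k%:R * (q - 1)) <= q * q ^+ k.
    by rewrite ler_pM2l// (lt_trans ltr01).
  have : 0 <= k%:R * (q - 1) * (q - 1) :> R by rewrite !mulr_ge0// subr_ge0 ltW.
  lra.
exists (Num.truncn (M / (q - 1))).+1 => j kj.
apply: le_trans (bern j); rewrite -lerBlDl.
have : M / (q - 1) <= j%:R.
  by rewrite (le_trans (ltW (truncnS_gt _)))// ler_nat.
rewrite ler_pdivrMr ?subr_gt0//; lra.
Qed.

(** The difference of the two sums telescopes up to k boundary terms. *)
Lemma sum_shift_le (t : nat -> R) (M : R) (k N : nat) :
  (forall j, 0 <= t j <= M) -> \sum_(0 <= j < N) (t j - t (j + k)%N) <= k%:R * M.
Proof.
move=> tM; elim: k => [|k IH].
  by rewrite mul0r big1// => j _; rewrite addn0 subrr.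
rewrite (eq_bigr (fun j =>
  (t j - t (j + k)%N) - (t (j.+1 + k)%N - t (j + k)%N))); last first.
  by move=> j _; rewrite addnS addSn; ring.
rewrite sumrB (telescope_sumr (fun j => t (j + k)%N))// -natr1 mulrDl mul1r add0n.
have := tM k; have := tM (N + k)%N; lra.
Qed.

(** Both powers tend to 1 as eps tends to 0. The witness solves
    ((1 + eps) / (1 - eps))^p = m' / m2, with m2 the midpoint of m and m'. *)
Lemma exists_dilation_gap (p m m' : R) : 0 < p -> 0 <= m < m' ->
  exists eps : R, [/\ 0 < eps, eps < 1 &
    m * (1 - eps) `^ (- p) < m' * (1 + eps) `^ (- p)].
Proof.
move=> p0 /andP[m0 mm'].
pose m2 := (m + m') / 2.
have mm2 : m < m2 by rewrite /m2; lra.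
have m2m' : m2 < m' by rewrite /m2; lra.
have m2p : 0 < m2 by rewrite (le_lt_trans m0).
have r1 : 1 < m' / m2 by rewrite ltr_pdivlMr// mul1r.
pose s := (m' / m2) `^ p^-1.
have s1 : 1 < s.
  suff : 1 `^ p^-1 < s by rewrite powR1.
  by rewrite /s gt0_ltr_powR ?invr_gt0// nnegrE// ltW// (lt_trans ltr01).
have sp : s `^ p = m' / m2.
  by rewrite /s -powRrM mulVf ?lt0r_neq0// powRr1// ltW// (lt_trans ltr01).
have s0 : 0 < s by rewrite (lt_trans ltr01).
have s2 : 0 < s + 1 by lra.
exists ((s - 1) / (s + 1)); split.
- by rewrite divr_gt0// subr_gt0.
- by rewrite ltr_pdivrMr//; lra.
have e1 : 1 - (s - 1) / (s + 1) = 2 / (s + 1).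
  by field; rewrite lt0r_neq0.
have e2 : 1 + (s - 1) / (s + 1) = s * (2 / (s + 1)).
  by field; rewrite lt0r_neq0.
have b0 : 0 < 2 / (s + 1) by rewrite divr_gt0.
rewrite e1 e2 powRM ?(ltW s0) ?(ltW b0)// mulrA ltr_pM2r ?powR_gt0//.
rewrite powRN sp invf_div.
by rewrite mulrCA mulfV ?mulr1// lt0r_neq0// (lt_trans m2p).
Qed.

End real_lemmas.

(** * Euclidean distance *)

Section euclidean_distance.
Context {R : realType} {n : nat}.
Implicit Types x y z : 'rV[R]_n.

(** Expand the nonnegative sum of the squares of [B * a i - C * b i]. *)
Lemma cauchy_schwarz_sum (a b : 'I_n -> R) :
  (\sum_i a i * b i) ^+ 2 <= (\sum_i a i ^+ 2) * (\sum_i b i ^+ 2).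
Proof.
set A := \sum_i a i ^+ 2; set B := \sum_i b i ^+ 2; set C := \sum_i a i * b i.
have B0 : 0 <= B by apply: sumr_ge0 => i _; exact: sqr_ge0.
have key : 0 <= B * (A * B - C ^+ 2).
  have -> : B * (A * B - C ^+ 2) = \sum_i (B * a i - C * b i) ^+ 2.
    rewrite (eq_bigr (fun i => B ^+ 2 * a i ^+ 2 +
      (- (2 * B * C) * (a i * b i) + C ^+ 2 * b i ^+ 2))); last first.
      by move=> i _; ring.
    by rewrite !big_split/= -!mulr_sumr -/A -/B -/C; ring.
  by apply: sumr_ge0 => i _; exact: sqr_ge0.
have [B00|Bn0] := eqVneq B 0.
  have b0 i : b i = 0.
    have /eqP := B00; rewrite psumr_eq0 => [/allP/(_ i)|j _]; last exact: sqr_ge0.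
    by rewrite mem_index_enum sqrf_eq0 => /(_ isT)/eqP.
  rewrite /C big1 ?expr0n/= ?mulr_ge0//.
    by apply: sumr_ge0 => i _; exact: sqr_ge0.
  by move=> i _; rewrite b0 mulr0.
by rewrite -subr_ge0; move: key; rewrite pmulr_rge0// lt_neqAle eq_sym Bn0.
Qed.

Lemma euclidean_norm_ge0 x : 0 <= euclidean_norm x.
Proof. exact: sqrtr_ge0. Qed.

Lemma sqr_euclidean_norm x :
  euclidean_norm x ^+ 2 = \sum_(i < n) (x ord0 i) ^+ 2.
Proof. by rewrite sqr_sqrtr//; apply: sumr_ge0 => i _; exact: sqr_ge0. Qed.

Lemma ler_euclidean_normD x y :
  euclidean_norm (x + y) <= euclidean_norm x + euclidean_norm y.
Proof.
rewrite -(@ler_pXn2r _ 2)// ?nnegrE ?addr_ge0 ?euclidean_norm_ge0//.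
rewrite sqrrD !sqr_euclidean_norm.
have -> : \sum_(i < n) (x + y) ord0 i ^+ 2 = \sum_(i < n) x ord0 i ^+ 2 +
    (\sum_(i < n) x ord0 i * y ord0 i) *+ 2 + \sum_(i < n) y ord0 i ^+ 2.
  rewrite -sumrMnl -!big_split/=; apply: eq_bigr => i _.
  by rewrite mxE sqrrD.
rewrite lerD2r lerD2l lerMn2r/=.
rewrite (le_trans (ler_norm _))//.
rewrite -(@ler_pXn2r _ 2)// ?nnegrE ?mulr_ge0 ?euclidean_norm_ge0//.
rewrite exprMn !sqr_euclidean_norm real_normK ?num_real//.
exact: cauchy_schwarz_sum.
Qed.

Lemma euclidean_normN (x : 'rV[R]_n) : euclidean_norm (- x) = euclidean_norm x.
Proof.
rewrite /euclidean_norm; congr Num.sqrt.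
by apply: eq_bigr => i _; rewrite mxE sqrrN.
Qed.

Lemma euclidean_norm_eq0 x : (euclidean_norm x == 0) = (x == 0).
Proof.
apply/idP/eqP => [|->]; last first.
  rewrite /euclidean_norm big1 ?sqrtr0// => i _.
  by rewrite mxE expr0n.
rewrite -sqrf_eq0 sqr_euclidean_norm psumr_eq0 => [/allP x0|i _]; last first.
  exact: sqr_ge0.
apply/rowP => i; rewrite mxE.
by have := x0 i (mem_index_enum _); rewrite sqrf_eq0 => /eqP.
Qed.

Lemma edist_ge0 x y : 0 <= edist x y.
Proof. exact: euclidean_norm_ge0. Qed.

Lemma edist_eq0 x y : (edist x y == 0) = (x == y).
Proof. by rewrite euclidean_norm_eq0 subr_eq0. Qed.

Lemma edistC x y : edist x y = edist y x.
Proof. by rewrite /edist -euclidean_normN opprB. Qed.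

Lemma edist_triangle x y z : edist x z <= edist x y + edist y z.
Proof.
rewrite /edist (_ : x - z = (x - y) + (y - z)); first exact: ler_euclidean_normD.
by rewrite addrA subrK.
Qed.

Lemma edistx0 x : edist x 0 = euclidean_norm x.
Proof. by rewrite /edist subr0. Qed.

(** Seen from x, a point that is much closer to the origin than x, or at least
    twice as far from it, is at distance almost |x| or more. *)
Lemma edist_ge_off_shell x y (eps : R) : 0 < eps ->
  euclidean_norm y <= eps * euclidean_norm x \/
    2 * euclidean_norm x <= euclidean_norm y ->
  (1 - eps) * euclidean_norm x <= edist x y.
Proof.
move=> eps0 [yx|xy].
  have := edist_triangle x y 0; rewrite !edistx0; lra.
have := edist_triangle y x 0; rewrite !edistx0 edistC.
have : 0 <= eps * euclidean_norm x by rewrite mulr_ge0 ?euclidean_norm_ge0// ltW.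
lra.
Qed.

End euclidean_distance.

(** * Riesz kernel *)

Section kernel.
Context {R : realType} {n : nat} (alpha : R).
Hypothesis halphan : alpha < n%:R.
Implicit Types x y z : 'rV[R]_n.

Lemma riesz_kernel_ge0 x y : (0 <= riesz_kernel alpha x y)%E.
Proof. by rewrite /riesz_kernel; case: ifP => // _; rewrite lee_fin powR_ge0. Qed.

Lemma riesz_kernelC x y : riesz_kernel alpha x y = riesz_kernel alpha y x.
Proof. by rewrite /riesz_kernel eq_sym edistC. Qed.

Let e0 : alpha - n%:R < 0. Proof. by rewrite subr_lt0. Qed.

Lemma riesz_kernel_le x y (r : R) : 0 < r -> r <= edist x y ->
  (riesz_kernel alpha x y <= (r `^ (alpha - n%:R))%:E)%E.
Proof.
move=> r0 rxy; rewrite /riesz_kernel ifF; last first.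
  by rewrite -edist_eq0; apply/negbTE/lt0r_neq0/(lt_le_trans r0).
by rewrite lee_fin le_powR_neg.
Qed.

Lemma riesz_kernel_ge x y (r : R) : edist x y <= r ->
  ((r `^ (alpha - n%:R))%:E <= riesz_kernel alpha x y)%E.
Proof.
move=> rxy; rewrite /riesz_kernel; case: ifPn => [_|]; first exact: leey.
rewrite -edist_eq0 => xy; rewrite lee_fin le_powR_neg//.
by rewrite lt_neqAle eq_sym xy edist_ge0.
Qed.

(** The kernel is decreasing and homogeneous of degree alpha - n in the
    distance. *)
Lemma riesz_kernel_scale x y z (t : R) : 0 < t -> edist z x <= t * edist y x ->
  (riesz_kernel alpha y x <= (t `^ (n%:R - alpha))%:E * riesz_kernel alpha z x)%E.
Proof.
move=> t0 zyx; rewrite {2}/riesz_kernel; case: ifPn => [_|zx].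
  by rewrite gt0_muley ?leey// lte_fin powR_gt0.
have zx0 : 0 < edist z x.
  by rewrite lt_neqAle edist_ge0 eq_sym edist_eq0 zx.
have yx0 : 0 < edist y x by rewrite -(pmulr_rgt0 _ t0) (lt_le_trans zx0).
rewrite (le_trans (riesz_kernel_le _ _ _ yx0 (lexx _)))// -EFinM lee_fin.
rewrite -[edist y x](mulKf (lt0r_neq0 t0)) powRM
  ?invr_ge0 ?mulr_ge0 ?(ltW t0) ?(ltW yx0)//.
rewrite -[t^-1]powR_inv1 ?(ltW t0)// -powRrM mulN1r opprB ler_pM2l ?powR_gt0//.
by apply: le_powR_neg.
Qed.

Lemma measurable_coord i :
  measurable_fun [set: borel R n] (fun x : borel R n => (x : 'rV[R]_n) ord0 i).
Proof.
apply: (measurability _ (RGenOpens.measurableE R)).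
move=> _ [_ [a [b ->] <-]]; rewrite setTI.
apply: sub_sigma_algebra.
have /continuousP := @coord_continuous R 1 n ord0 i.
by apply; exact: interval_open.
Qed.

Lemma measurable_edist :
  measurable_fun [set: borel R n * borel R n]
  (fun u => edist (u.1 : 'rV[R]_n) u.2).
Proof.
apply: (measurableT_comp (f := @Num.sqrt R)).
  apply: continuous_measurable_fun; exact: sqrt_continuous.
apply: measurable_sum => i; apply: measurable_funX.
under eq_fun do rewrite !mxE.
apply: measurable_funB.
  exact: (measurableT_comp (measurable_coord i) measurable_fst).
exact: (measurableT_comp (measurable_coord i) measurable_snd).
Qed.

Lemma measurable_riesz_kernel : measurable_fun [set: borel R n * borel R n]
  (fun u => riesz_kernel alpha (u.1 : 'rV[R]_n) u.2).
Proof.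
apply: measurable_fun_ifT => //.
  under eq_fun do rewrite -edist_eq0.
  apply: measurable_fun_eqr => //; exact: measurable_edist.
apply/measurable_EFinP.
apply: (measurableT_comp (f := fun d : R => d `^ (alpha - n%:R))).
  exact: measurable_powR.
exact: measurable_edist.
Qed.

End kernel.

(** * Iterated integrals of finite measures *)

(** A measure does not carry the fact that it is finite in its type: this copy
    of it does, so that the theorems about products of sigma-finite measures
    apply. *)
Definition as_finite d (T : measurableType d) (R : realType)
  (mu : {measure set T -> \bar R}) (muT : (mu setT < +oo)%E) :
  set T -> \bar R := mu.

Section as_finite_instance.
Context d (T : measurableType d) (R : realType) (mu : {measure set T -> \bar R}).
Context (muT : (mu setT < +oo)%E).

HB.instance Definition _ := isMeasure.Build _ _ _ (as_finite d T R mu muT)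
  (measure0 mu) (measure_ge0 mu) (@measure_semi_sigma_additive _ _ _ mu).

Let fin : fin_num_fun (as_finite d T R mu muT).
Proof.
move=> A mA; rewrite ge0_fin_numE ?measure_ge0//.
by rewrite (le_lt_trans _ muT)// le_measure ?inE.
Qed.

HB.instance Definition _ :=
  Measure_isFinite.Build d T R (as_finite d T R mu muT) fin.
End as_finite_instance.

Section fubini_on.
Context d1 d2 (T1 : measurableType d1) (T2 : measurableType d2) (R : realType).
Variables (m1 : {sigma_finite_measure set T1 -> \bar R}).
Variables (m2 : {sigma_finite_measure set T2 -> \bar R}).
Local Open Scope ereal_scope.

(** Moves the restriction to sets from the domains of an iterated integral to
    its integrand, where the theorems on product measures can see it. *)
Lemma integral_patch_setX d (T : measurableType d) (S : Type)
    (m : {measure set T -> \bar R}) (A : set S) (B : set T)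
    (f : S -> T -> \bar R) x :
  ((fun s => \int[m]_(y in B) f s y) \_ A) x =
  \int[m]_y ((fun u => f u.1 u.2) \_ (A `*` B)) (x, y).
Proof.
rewrite patchE; case: ifPn => [|/negP]; rewrite inE => xA.
  rewrite integral_mkcond; apply: eq_integral => y _.
  rewrite !patchE; case: ifPn => [|/negP]; rewrite inE => yB.
    by rewrite ifT// inE; split.
  by rewrite ifF//; apply/negP; rewrite inE => -[].
rewrite integral0_eq// => y _; rewrite patchE ifF//.
by apply/negP; rewrite inE => -[].
Qed.

Lemma fubini_tonelli_on (A : set T1) (B : set T2) (f : T1 -> T2 -> \bar R) :
  measurable A -> measurable B ->
  measurable_fun setT (fun u : T1 * T2 => f u.1 u.2) ->
  (forall x y, 0 <= f x y) ->
  \int[m1]_(x in A) \int[m2]_(y in B) f x y =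
  \int[m2]_(y in B) \int[m1]_(x in A) f x y.
Proof.
move=> mA mB mf f0; rewrite integral_mkcond [RHS]integral_mkcond.
under eq_integral do rewrite integral_patch_setX.
under [RHS]eq_integral do
  rewrite (integral_patch_setX _ _ _ m1 B A (fun y x => f x y)).
rewrite fubini_tonelli.
- apply: eq_integral => y _; apply: eq_integral => x _; rewrite !patchE/=.
  congr (if _ then _ else _).
  by apply/idP/idP; rewrite !inE => -[].
- apply/(measurable_restrictT _ (measurableX mA mB)).
  exact: measurable_funTS.
- by move=> u; rewrite patchE; case: ifP.
Qed.

End fubini_on.

Lemma finite_fubini_on d1 d2 (T1 : measurableType d1) (T2 : measurableType d2)
    (R : realType) (m1 : {measure set T1 -> \bar R})
    (m2 : {measure set T2 -> \bar R}) (A : set T1) (B : set T2)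
    (f : T1 -> T2 -> \bar R) :
  (m1 setT < +oo)%E -> (m2 setT < +oo)%E -> measurable A -> measurable B ->
  measurable_fun setT (fun u : T1 * T2 => f u.1 u.2) ->
  (forall x y, (0 <= f x y)%E) ->
  (\int[m1]_(x in A) \int[m2]_(y in B) f x y =
   \int[m2]_(y in B) \int[m1]_(x in A) f x y)%E.
Proof.
move=> m1T m2T.
exact: (fubini_tonelli_on _ _ _ _ _ (as_finite _ _ _ m1 m1T)
  (as_finite _ _ _ m2 m2T)).
Qed.

(** * Weak maximum principle *)

Section maximum_principle.
Context {R : realType} {n : nat} (alpha : R).
Hypothesis halphan : alpha < n%:R.
Local Open Scope ereal_scope.
Local Notation kappa := (riesz_kernel alpha).
Local Notation p := (n%:R - alpha)%R.

Lemma measurable_kernelr (D : set (borel R n)) (y : 'rV[R]_n) :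
  measurable_fun D (fun x : borel R n => kappa y x).
Proof.
apply: measurable_funTS.
exact: (measurable_fun_pair2 _ (measurable_riesz_kernel alpha)).
Qed.

Lemma measurable_edistr (D : set (borel R n)) (y : 'rV[R]_n) :
  measurable_fun D (fun x : borel R n => edist y x).
Proof.
apply: measurable_funTS.
exact: (measurable_fun_pair2 _ measurable_edist).
Qed.

(** If z is at most twice as far from y as any point of G, then for x in G
    |z - x| <= |z - y| + |y - x| <= 3 |y - x|. *)
Lemma exists_almost_nearest (G : set 'rV[R]_n) (y : 'rV[R]_n) (r : R) :
  (0 < r)%R -> (forall x, G x -> (r <= edist y x)%R) -> G !=set0 ->
  exists2 z, G z & forall x, G x -> (edist z x <= 3 * edist y x)%R.
Proof.
move=> r0 Gr [x0 Gx0].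
pose D := [set edist y x | x in G].
have hD : has_inf D.
  split; first by exists (edist y x0); exists x0.
  by exists r => _ [x Gx <-]; exact: Gr.
have d0 : (0 < inf D)%R.
  rewrite (lt_le_trans r0)//; apply: lb_le_inf; first by case: hD.
  by move=> _ [x Gx <-]; exact: Gr.
have [_ [z Gz <-] zD] := inf_adherent d0 hD.
exists z => // x Gx.
have : (inf D <= edist y x)%R by apply: ge_inf; [case: hD|exists x].
have := edist_triangle z y x; rewrite (edistC z y); lra.
Qed.

(** For y outside F, replace y by an almost nearest point z of F: this triples
    the distances to F at most, hence divides the kernel by 3^p at most. Since F
    need not be closed, such a z may not exist; it does for the points of F at
    distance at least 1/k from y, and F is the increasing union of these
    parts. *)
Lemma weak_maximum_principle (mu : {measure set (borel R n) -> \bar R})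
    (F : set (borel R n)) (M : R) : measurable F -> (0 <= M)%R ->
  (forall x, F x -> \int[mu]_(y in F) kappa x y <= M%:E) ->
  forall y, \int[mu]_(x in F) kappa y x <= (3 `^ p * M)%:E.
Proof.
move=> mF M0 FM y.
have p0 : (0 < p)%R by rewrite subr_gt0.
have [Fy|nFy] := pselect (F y).
  apply: (le_trans (FM _ Fy)); rewrite lee_fin ler_peMl//.
  by rewrite -[leLHS](powRr0 3) ler_powR ?ler1n ?(ltW p0).
pose G k : set (borel R n) := F `&` [set x | k.+1%:R^-1 <= edist y x]%R.
have mG k : measurable (G k).
  rewrite /G -[X in _ `&` X]setTI; apply: measurableI => //.
  rewrite (_ : [set x | _] =
      (fun x : borel R n => edist y x) @^-1` [set` `[k.+1%:R^-1%R, +oo[%R]).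
    exact: measurable_edistr.
  by apply/seteqP; split => x/=; rewrite in_itv/= andbT.
have -> : F = \bigcup_k G k.
  apply/seteqP; split => [x Fx|x [k _ []]//].
  have d0 : (0 < edist y x)%R.
    rewrite lt_neqAle eq_sym edist_eq0 edist_ge0 andbT.
    by apply: contra_notN nFy => /eqP ->.
  exists (Num.truncn (edist y x)^-1) => //; split => //=.
  rewrite -[leRHS]invrK lef_pV2 ?posrE ?invr_gt0//.
  by rewrite ltW// truncnS_gt.
have cvgG : \int[mu]_(x in G k) kappa y x @[k --> \oo] -->
    \int[mu]_(x in \bigcup_k G k) kappa y x.
  apply: ge0_nondecreasing_set_cvg_integral => //.
  - apply/nondecreasing_seqP => k; rewrite subsetEset => x [Fx xk]; split => //=.
    by rewrite (le_trans _ xk)// lef_pV2 ?posrE// ler_nat.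
  - by move=> i; exact: measurable_kernelr.
  - by move=> *; exact: riesz_kernel_ge0.
rewrite -(cvg_lim _ cvgG)//.
apply: lime_le; first by apply/cvg_ex; eexists; exact: cvgG.
apply: nearW => k.
have [->|/set0P G0] := eqVneq (G k) set0.
  by rewrite integral_set0 lee_fin mulr_ge0 ?powR_ge0.
have [z [Fz _] zG] := exists_almost_nearest (G k) y k.+1%:R^-1
  ltac:(by rewrite invr_gt0) (fun x h => proj2 h) G0.
apply: (@le_trans _ _ (\int[mu]_(x in G k) ((3 `^ p)%:E * kappa z x))).
  apply: ge0_le_integral => //.
  - by move=> *; exact: riesz_kernel_ge0.
  - exact: measurable_kernelr.
  - by apply: measurable_funeM; exact: measurable_kernelr.
  - by move=> x Gx; apply: riesz_kernel_scale => //; exact: zG.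
rewrite ge0_integralZl_EFin ?powR_ge0//; last 2 first.
  - by move=> *; exact: riesz_kernel_ge0.
  - exact: measurable_kernelr.
rewrite EFinM; apply: lee_pmul => //; rewrite ?lee_fin ?powR_ge0//.
  by apply: integral_ge0 => *; exact: riesz_kernel_ge0.
rewrite (le_trans _ (FM _ Fz))//; apply: ge0_subset_integral => //.
- exact: measurable_kernelr.
- by move=> *; exact: riesz_kernel_ge0.
- by move=> x [].
Qed.
End maximum_principle.

(** * Energy and inner capacity *)

Section energy.
Context {R : realType} {n : nat} (alpha : R).
Hypothesis halphan : alpha < n%:R.
Local Open Scope ereal_scope.
Local Notation kappa := (riesz_kernel alpha).
Local Notation p := (n%:R - alpha)%R.
Implicit Types mu nu : {measure set (borel R n) -> \bar R}.

Lemma energy_integral_potential mu : mu setT < +oo ->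
  energy alpha mu = \int[mu]_x potential alpha mu x.
Proof.
move=> muT.
pose m := as_finite _ _ _ mu muT.
rewrite /energy -[LHS]/(\int[m \x m]_u kappa u.1 u.2) fubini_tonelli1//.
  exact: measurable_riesz_kernel.
by move=> u; exact: riesz_kernel_ge0.
Qed.

Lemma measurable_potential_on mu (D L : set (borel R n)) : mu setT < +oo ->
  measurable L ->
  measurable_fun D (fun x : borel R n => \int[mu]_(y in L) kappa x y).
Proof.
move=> muT mL; apply: measurable_funTS.
rewrite (_ : (fun x => _) =
    fun x => \int[mu]_y ((fun u => kappa u.1 u.2) \_ (setT `*` L)) (x, y)).
  apply: (@measurable_fun_fubini_tonelli_F _ _ _ _ _ (as_finite _ _ _ mu muT)
    ((fun u : borel R n * borel R n => kappa u.1 u.2) \_ (setT `*` L))).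
    apply/(measurable_restrictT _ (measurableX _ _)) => //.
    by apply: measurable_funTS; exact: measurable_riesz_kernel.
  by move=> u; rewrite patchE; case: ifP => // _; exact: riesz_kernel_ge0.
by apply/funext => x; rewrite -integral_patch_setX patch_setT.
Qed.

Lemma mutual_energyC mu nu (F L : set (borel R n)) :
  mu setT < +oo -> nu setT < +oo -> measurable F -> measurable L ->
  \int[mu]_(x in F) \int[nu]_(y in L) kappa x y =
  \int[nu]_(y in L) \int[mu]_(x in F) kappa y x.
Proof.
move=> muT nuT mF mL.
have -> := finite_fubini_on _ _ _ _ _ mu nu F L kappa muT nuT mF mL
  (measurable_riesz_kernel alpha) (riesz_kernel_ge0 alpha).
by apply: eq_integral => y _; apply: eq_integral => x _; exact: riesz_kernelC.
Qed.

(** Comparison of c mu(F) with the mutual energy of nu restricted to L and mu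
    restricted to F, where F is the part of A on which the potential of mu is at
    most 2 t, so that mu(F) >= 1/2. *)
Lemma energy_lower_bound mu nu A (L : set (borel R n)) (c t : R) :
  concentrated mu A -> mu setT = 1 -> nu setT < +oo -> measurable L ->
  (0 <= c)%R -> (0 < t)%R -> energy alpha mu <= t%:E ->
  (forall x, A x -> c%:E <= \int[nu]_(y in L) kappa x y) ->
  c%:E <= (4 * 3 `^ p * t)%:E * nu L.
Proof.
move=> [N [mN muN AN]] muT1 nuT mL c0 t0 mut Ac.
have muT : mu setT < +oo by rewrite muT1 ltry.
have mpot := measurable_potential_on mu setT _ muT measurableT.
have pot0 x : 0 <= potential alpha mu x.
  by apply: integral_ge0 => y _; exact: riesz_kernel_ge0.
pose B : set (borel R n) := [set x | (2 * t)%:E < potential alpha mu x].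
have mB : measurable B.
  by rewrite -[B]setTI; exact: emeasurable_fun_o_infty.
have muB : (2 * t)%:E * mu B <= t%:E.
  apply: le_trans mut; rewrite energy_integral_potential//.
  apply: (@le_trans _ _ (\int[mu]_(x in B) potential alpha mu x)); last first.
    by apply: ge0_subset_integral.
  rewrite -integral_cst//; apply: ge0_le_integral => //.
  - by move=> x _; rewrite lee_fin mulr_ge0 ?ltW.
  - exact: measurable_funTS.
  - by move=> x /ltW.
(* Removing the null set N puts F inside A, which need not be measurable. *)
pose F : set (borel R n) := ~` N `&` ~` B.
have mF : measurable F by apply: measurableI; exact: measurableC.
have muF : 1 <= 2%:E * mu F.
  have h : 1 <= mu F + mu B.
    rewrite -muT1 (_ : setT = (F `|` B) `|` N); last first.
      apply/seteqP; split => // x _.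
      have [Nx|Nx] := pselect (N x); first by right.
      by left; have [Bx|Bx] := pselect (B x); [right|left].
    have mFB : measurable (F `|` B) by exact: measurableU.
    apply: (le_trans (measureU2 mu mFB mN)).
    by rewrite [X in _ + X]muN adde0; apply: measureU2.
  have fF : mu F \is a fin_num.
    by rewrite ge0_fin_numE// (le_lt_trans _ muT)// le_measure ?inE.
  have fB : mu B \is a fin_num.
    by rewrite ge0_fin_numE// (le_lt_trans _ muT)// le_measure ?inE.
  move: h muB; rewrite -(fineK fF) -(fineK fB) -EFinD -!EFinM !lee_fin => h1 h2.
  have : (2 * fine (mu B) <= 1)%R.
    by rewrite -(ler_pM2r t0) mul1r mulrAC.
  lra.
have FM x : F x -> \int[mu]_(y in F) kappa x y <= (2 * t)%:E.
  move=> [_ /negP]; rewrite -leNgt; apply: le_trans.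
  apply: ge0_subset_integral => //; first exact: measurable_kernelr.
  by move=> *; exact: riesz_kernel_ge0.
have maxF := weak_maximum_principle alpha halphan mu F _ mF
  (mulr_ge0 (ler0n R 2) (ltW t0)) FM.
suff cF : c%:E * mu F <= (3 `^ p * (2 * t))%:E * nu L.
  apply: (@le_trans _ _ (2%:E * (c%:E * mu F))).
    by rewrite muleCA lee_pemulr.
  rewrite (_ : 4 * 3 `^ p * t = 2 * (3 `^ p * (2 * t)))%R; last by ring.
  by rewrite EFinM -muleA lee_pmul2l.
apply: (@le_trans _ _ (\int[mu]_(x in F) \int[nu]_(y in L) kappa x y)).
  rewrite -integral_cst//; apply: ge0_le_integral => //.
  - exact: measurable_potential_on.
  - by move=> x [Nx _]; apply: Ac; apply: contrapT => /AN.
rewrite mutual_energyC//.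
apply: (@le_trans _ _ (\int[nu]_(y in L) (3 `^ p * (2 * t))%:E)).
  apply: ge0_le_integral => //.
  - by move=> y _; apply: integral_ge0 => x _; exact: riesz_kernel_ge0.
  - exact: measurable_potential_on.
by have -> := integral_cst nu mL (3 `^ p * (2 * t))%:E.
Qed.

End energy.

Section inner_capacity.
Context {R : realType} {n : nat} (alpha : R).
Hypothesis halphan : alpha < n%:R.
Local Open Scope ereal_scope.
Local Notation kappa := (riesz_kernel alpha).
Local Notation p := (n%:R - alpha)%R.
Implicit Types mu nu : {measure set (borel R n) -> \bar R}.

Lemma energy_ge0 mu : mu setT = 1 -> 0 <= energy alpha mu.
Proof.
move=> mu1; rewrite energy_integral_potential ?mu1 ?ltry//.
by apply: integral_ge0 => x _; apply: integral_ge0 => y _; exact: riesz_kernel_ge0.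
Qed.

Lemma inner_capacity_ge0 (A : set 'rV[R]_n) : 0 <= inner_capacity alpha A.
Proof.
rewrite inve_ge0; apply: le_ereal_inf_tmp => _ [mu [_ mu1] <-]; exact: energy_ge0.
Qed.

(** The bound of [energy_lower_bound] holds for every t above the energy of
    every competitor, hence passes to their infimum. *)
Lemma inner_capacity_le nu (A : set 'rV[R]_n) (L : set (borel R n)) (c : R) :
  nu setT < +oo -> measurable L -> (0 < c)%R ->
  (forall x, A x -> c%:E <= \int[nu]_(y in L) kappa x y) ->
  inner_capacity alpha A <= (4 * 3 `^ p / c)%:E * nu L.
Proof.
move=> nuT mL c0 Ac.
have K0 : (0 < 4 * 3 `^ p)%R by rewrite mulr_gt0 ?powR_gt0.
set K : R := (4 * 3 `^ p)%R in K0 *.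
have nuLfin : nu L \is a fin_num.
  by rewrite ge0_fin_numE// (le_lt_trans _ nuT)// le_measure ?inE.
have v0 : (0 <= fine (nu L))%R by rewrite fine_ge0.
have bound mu t : in_Eplus alpha A mu -> mu setT = 1 -> (0 < t)%R ->
    energy alpha mu <= t%:E -> (c <= K * t * fine (nu L))%R.
  move=> [_ muA _] mu1 t0 mut; rewrite -lee_fin EFinM fineK//.
  exact: (energy_lower_bound alpha halphan mu nu A L c t muA mu1 nuT mL
    (ltW c0) t0 mut Ac).
rewrite -(fineK nuLfin) -EFinM; set v := fine (nu L) in v0 bound *.
have w0 : (0 <= K / c * v)%R by rewrite mulr_ge0// divr_ge0 ?ltW.
rewrite inve_ple ?inE ?lee_fin//; last first.
  by apply: le_ereal_inf_tmp => _ [mu [_ mu1] <-]; exact: energy_ge0.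
apply: le_ereal_inf_tmp => _ [mu [muE mu1] <-].
have fe : energy alpha mu \is a fin_num.
  by rewrite ge0_fin_numE ?energy_ge0//; case: muE.
have e0 : (0 <= fine (energy alpha mu))%R by rewrite fine_ge0 ?energy_ge0.
have {}bound t : (fine (energy alpha mu) < t)%R -> (c <= K * t * v)%R.
  move=> et; apply: (bound mu) => //; first exact: le_lt_trans et.
  by rewrite -(fineK fe) lee_fin ltW.
move: (energy alpha mu) fe e0 bound => e fe e0 bound.
(* If nu does not charge L, there is no competitor at all. *)
have vn0 : (v != 0)%R.
  apply/eqP => v00; have := bound (fine e + 1)%R.
  by rewrite ltrDl ltr01 v00 mulr0 leNgt c0 => /(_ isT).
have vp : (0 < v)%R by rewrite lt_neqAle eq_sym vn0.
rewrite inver ifF; last by apply/negbTE; rewrite !mulf_neq0 ?invr_neq0// lt0r_neq0.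
rewrite -(fineK fe) lee_fin.
apply/ler_addgt0Pr => eps eps0.
rewrite -div1r ler_pdivrMr ?mulr_gt0 ?invr_gt0//.
have /bound : (fine e < fine e + eps)%R by rewrite ltrDl.
rewrite -(ler_pM2r (x := c^-1)) ?invr_gt0// divff ?lt0r_neq0// => /le_trans; apply.
by rewrite le_eqVlt; apply/orP; left; apply/eqP; ring.
Qed.

End inner_capacity.

(** * Thinness at infinity *)

Section shell_estimates.
Context {R : realType} {n : nat} (alpha : R).
Hypothesis halphan : alpha < n%:R.
Local Open Scope ereal_scope.
Local Notation kappa := (riesz_kernel alpha).
Local Notation p := (n%:R - alpha)%R.
Implicit Types mu nu : {measure set (borel R n) -> \bar R}.

Lemma measurable_norm_gt (r : R) :
  measurable ([set y | (r < euclidean_norm y)%R] : set (borel R n)).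
Proof.
rewrite (_ : [set y | _] =
    (fun y : borel R n => edist 0 y) @^-1` [set` `]r, +oo[%R]).
  by rewrite -[_ @^-1` _]setTI; exact: measurable_edistr.
by apply/seteqP; split => x/=; rewrite in_itv/= andbT edistC edistx0.
Qed.

Lemma measurable_norm_le (r : R) :
  measurable ([set y | (euclidean_norm y <= r)%R] : set (borel R n)).
Proof.
rewrite (_ : [set y | _] = ~` [set y | (r < euclidean_norm y)%R]).
  by apply: measurableC; exact: measurable_norm_gt.
by apply/seteqP; split => y /=; rewrite leNgt => /negP.
Qed.

(** The weights of the series match the size of the kernel on the annulus: the
    powers of q that depend on j cancel. *)
Lemma capacity_annulus_le nu (A : set 'rV[R]_n) (L : set (borel R n))
    (q c : R) (j : nat) :
  (1 < q)%R -> (0 < c)%R -> nu setT < +oo -> measurable L ->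
  (forall x, A x ->
    (c * (q ^+ j.+1) `^ (alpha - n%:R))%:E <= \int[nu]_(y in L) kappa x y) ->
  inner_capacity alpha A / (q `^ (j%:R * p))%:E <=
    (4 * 3 `^ p * q `^ p / c)%:E * nu L.
Proof.
move=> q1 c0 nuT mL Ac; have q0 : (0 < q)%R by rewrite (lt_trans ltr01).
have w0 : (0 < c * (q ^+ j.+1) `^ (alpha - n%:R))%R.
  by rewrite mulr_gt0// powR_gt0// exprn_gt0.
have := inner_capacity_le alpha halphan nu A L _ nuT mL w0 Ac.
rewrite inver ifF; last by apply/negbTE/lt0r_neq0/powR_gt0.
have d0 : (0 < (q `^ (j%:R * p))^-1)%R by rewrite invr_gt0 powR_gt0.
rewrite -(lee_pmul2r (x := ((q `^ (j%:R * p))^-1)%:E))//.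
move=> /le_trans; apply; rewrite muleAC -EFinM.
apply: lee_wpmul2r; first exact: measure_ge0.
rewrite lee_fin le_eqVlt; apply/orP; left; apply/eqP.
have -> : ((q ^+ j.+1) `^ (alpha - n%:R) = (q `^ p)^-1 * (q `^ (j%:R * p))^-1)%R.
  rewrite -!powRN -powRD; last by rewrite lt0r_neq0 ?implybT.
  rewrite -powR_mulrn ?ltW// -powRrM; congr powR.
  by rewrite -natr1; ring.
have qp := powR_gt0 p q0; have qj := powR_gt0 (j%:R * p) q0.
by field; rewrite !lt0r_neq0.
Qed.

Lemma exists_ball_mass_gt mu (m : R) : m%:E < mu setT ->
  exists k : nat, exists2 m' : R, (m < m')%R &
    m'%:E <= mu [set y | (euclidean_norm y <= k%:R)%R].
Proof.
move=> mmu.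
pose B (k : nat) : set (borel R n) := [set y | (euclidean_norm y <= k%:R)%R].
have mB k : measurable (B k) by exact: measurable_norm_le.
have UB : \bigcup_k B k = setT.
  apply/seteqP; split => // y _; exists (Num.truncn (euclidean_norm y)).+1 => //.
  exact/ltW/truncnS_gt.
have cvgB : (mu \o B) k @[k --> \oo] --> mu (\bigcup_k B k).
  apply: nondecreasing_cvg_mu => //; first by rewrite UB.
  move=> i j ij; rewrite subsetEset => y /= /le_trans; apply.
  by rewrite ler_nat.
have [k mk] : exists k, m%:E < mu (B k).
  apply: contrapT => /forallNP H.
  move: mmu; rewrite -UB -(cvg_lim _ cvgB)// ltNge => /negP; apply.
  apply: lime_le; first by apply/cvg_ex; eexists; exact: cvgB.
  by apply: nearW => k; rewrite leNgt; apply/negP; exact: H.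
exists k; rewrite -/(B k); move: (mu (B k)) mk => [r||]//.
- by rewrite lte_fin => mr; exists r.
- by move=> _; exists (m + 1)%R; rewrite ?leey// ltrDl.
Qed.

End shell_estimates.

Section thinness.
Context {R : realType} {n : nat} (alpha : R).
Hypothesis halphan : alpha < n%:R.
Local Open Scope ereal_scope.
Local Notation kappa := (riesz_kernel alpha).
Local Notation p := (n%:R - alpha)%R.
Implicit Types mu nu : {measure set (borel R n) -> \bar R}.
Let p0 : (0 < p)%R. Proof. by rewrite subr_gt0. Qed.
Let e0 : (alpha - n%:R < 0)%R. Proof. by rewrite subr_lt0. Qed.

Lemma integral_kernel_off_le nu (L : set (borel R n)) (r : R) x :
  measurable L -> (0 < r)%R -> (forall y, ~ L y -> (r <= edist x y)%R) ->
  \int[nu]_(y in setT) kappa x y <=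
    \int[nu]_(y in L) kappa x y + (r `^ (alpha - n%:R))%:E * nu setT.
Proof.
move=> mL r0 Lr; rewrite -{1}(setUv L) ge0_integral_setU//; last 4 first.
- exact: measurableC.
- exact: measurable_kernelr.
- by move=> *; exact: riesz_kernel_ge0.
- by apply/disj_setPS => y [].
apply: leeD2l.
apply: (@le_trans _ _
  (\int[nu]_(y in ~` L) (r `^ (alpha - n%:R))%:E)).
  apply: ge0_le_integral => //.
  - exact: measurableC.
  - by move=> *; exact: riesz_kernel_ge0.
  - exact: measurable_kernelr.
  - by move=> y /Lr; exact: riesz_kernel_le.
have -> := integral_cst nu (measurableC mL) (r `^ (alpha - n%:R))%:E.
by rewrite lee_wpmul2l ?lee_fin ?powR_ge0// le_measure ?inE//; exact: measurableC.
Qed.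

Lemma integral_kernel_ball_ge mu (B : set (borel R n)) (r : R) x :
  measurable B -> (forall y, B y -> (edist x y <= r)%R) ->
  (r `^ (alpha - n%:R))%:E * mu B <= potential alpha mu x.
Proof.
move=> mB Br.
apply: (@le_trans _ _ (\int[mu]_(y in B) kappa x y)); last first.
  apply: ge0_subset_integral => //; first exact: measurable_kernelr.
  by move=> *; exact: riesz_kernel_ge0.
have <- := integral_cst mu mB (r `^ (alpha - n%:R))%:E.
apply: ge0_le_integral => //.
- by move=> y _; rewrite lee_fin powR_ge0.
- exact: measurable_kernelr.
- by move=> y /Br; exact: riesz_kernel_ge.
Qed.

(** Near infinity, nu can only make up for its smaller mass through the part of
    it that is close to x. *)
Lemma local_potential_ge mu nu (L : set (borel R n)) (x : 'rV[R]_n)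
    (eps m m' k : R) :
  (0 < eps < 1)%R -> (0 < euclidean_norm x)%R ->
  (k <= eps * euclidean_norm x)%R -> measurable L ->
  nu setT = m%:E -> m'%:E <= mu [set y | (euclidean_norm y <= k)%R] ->
  (forall y, ~ L y -> ((1 - eps) * euclidean_norm x <= edist x y)%R) ->
  potential alpha mu x <= potential alpha nu x ->
  ((m' * (1 + eps) `^ (- p) - m * (1 - eps) `^ (- p)) *
    euclidean_norm x `^ (alpha - n%:R))%:E <= \int[nu]_(y in L) kappa x y.
Proof.
move=> /andP[eps0 eps1] + kX mL nuE muB offL munu.
set X := euclidean_norm x in kX offL * => X0.
have low : ((m' * (1 + eps) `^ (- p)) * X `^ (alpha - n%:R))%:E <=
    potential alpha mu x.
  apply: (le_trans _ (integral_kernel_ball_ge mu _ ((1 + eps) * X)%R x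
    (measurable_norm_le k) _)).
    apply: (@le_trans _ _ ((((1 + eps) * X) `^ (alpha - n%:R))%:E * m'%:E)).
      rewrite -EFinM lee_fin powRM ?(ltW X0) ?addr_ge0 ?(ltW eps0)// opprB.
      by rewrite le_eqVlt; apply/orP; left; apply/eqP; ring.
    by rewrite lee_wpmul2l// lee_fin powR_ge0.
  move=> y /= yk; have := edist_triangle x 0 y.
  by rewrite (edistC 0 y) !edistx0 -/X; lra.
have X1 : (0 < (1 - eps) * X)%R by rewrite mulr_gt0// subr_gt0.
have := integral_kernel_off_le nu L _ x mL X1 offL.
move=> /(le_trans munu)/(le_trans low).
rewrite nuE -EFinM addeC -leeBlDl// -EFinB.
apply: le_trans; rewrite lee_fin powRM ?(ltW X0) ?subr_ge0 ?(ltW eps1)// opprB.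
by rewrite le_eqVlt; apply/orP; left; apply/eqP; ring.
Qed.

(** The first j0 terms of the series are bounded by comparison with the
    potential of a point mass at the origin; from j0 on, the ball that carries
    the mass m' is small compared with |x| and [local_potential_ge] applies. *)
Lemma thin_at_infinity_of_mass_lt mu nu (A : set 'rV[R]_n) :
  nu setT < mu setT ->
  (forall x, A x -> potential alpha mu x <= potential alpha nu x) ->
  inner_thin_at_infinity alpha A.
Proof.
move=> numu AP.
have nuT : nu setT < +oo by rewrite (lt_le_trans numu) ?leey.
have nufin (D : set (borel R n)) : measurable D -> nu D \is a fin_num.
  move=> mD; rewrite ge0_fin_numE// (le_lt_trans _ nuT)// le_measure ?inE//.
have nuE : nu setT = (fine (nu setT))%:E by rewrite fineK// nufin.
set m := fine (nu setT) in nuE.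
have m0 : (0 <= m)%R by rewrite fine_ge0.
have := numu; rewrite {1}nuE => /exists_ball_mass_gt[k [m' mm' muB]].
have /(exists_dilation_gap p m m' p0)[eps [eps0 eps1]] : (0 <= m < m')%R.
  by rewrite m0.
rewrite -subr_gt0; set delta := (_ - _)%R => d0.
exists 0%R => q q1.
have q0 : (0 < q)%R by rewrite (lt_trans ltr01).
have [j0 hj0] := exprn_unbounded q (k%:R / eps)%R q1.
(* With this l, the upper end eps q^(j+l) of the j-th shell is at least
   2 q^(j+1). *)
have [l hl] := exprn_unbounded q (2 * q / eps)%R q1.
pose T j : set (borel R n) := [set y | (eps * q ^+ j < euclidean_norm y)%R].
have mT j : measurable (T j) by exact: measurable_norm_gt.
pose L j := T j `\` T (j + l)%N.
have mL j : measurable (L j) by exact: measurableD.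
pose t j := fine (nu (T j)).
have tm j : (0 <= t j <= m)%R.
  rewrite fine_ge0//= fine_le ?nufin// le_measure ?inE//.
have nuL j : nu (L j) = (t j - t (j + l)%N)%:E.
  have Tsub : T (j + l)%N `<=` T j.
    move=> y; apply: le_lt_trans; rewrite ler_pM2l// ler_weXn2l ?leq_addr//.
    exact: ltW.
  rewrite EFinB !fineK ?nufin// measureD//; first by rewrite setIidr.
  by rewrite (le_lt_trans _ nuT)// le_measure ?inE.
have LX x j y : (q ^+ j <= euclidean_norm x < q ^+ j.+1)%R -> ~ L j y ->
    ((1 - eps) * euclidean_norm x <= edist x y)%R.
  move=> /andP[jx xj] nL; apply: edist_ge_off_shell => //.
  have qj0 : (0 < q ^+ j)%R by rewrite exprn_gt0.
  have [/= Ty|/negP] := pselect (T j y); last first.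
    rewrite /T/= -leNgt => yj; left; apply: (le_trans yj).
    by rewrite ler_pM2l.
  right; have : T (j + l)%N y by apply: contrapT => nT; apply: nL.
  rewrite /T/= => yj.
  have : (2 * q ^+ j.+1 <= eps * q ^+ (j + l))%R.
    have := hl l (leqnn _); rewrite ler_pdivrMr// -(ler_pM2l qj0) exprS exprD.
    by move: (q ^+ j)%R (q ^+ l)%R => Q P; lra.
  lra.
pose C := (4 * 3 `^ p * q `^ p)%R.
have C0 : (0 <= C)%R by rewrite /C !mulr_ge0 ?powR_ge0.
(* Written as shifted differences, both parts of the majorant w are summed by
   [sum_shift_le]; note that s (j + j0) = 0. *)
pose s j : R := (j < j0)%:R.
pose w j : R := (C * (s j - s (j + j0)%N) + C / delta * (t j - t (j + l)%N))%R.
pose u j := inner_capacity alpha (A `&` annulus q 0 j) / (q `^ (j%:R * p))%:E.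
have u0 j : 0 <= u j.
  by rewrite mule_ge0 ?inner_capacity_ge0// inve_ge0 lee_fin powR_ge0.
have sE j : (s j - s (j + j0)%N)%R = s j.
  by rewrite /s [(j + j0 < j0)%N]ltnNge leq_addl subr0.
have powx (x : 'rV[R]_n) j : (q ^+ j <= euclidean_norm x < q ^+ j.+1)%R ->
    ((q ^+ j.+1) `^ (alpha - n%:R) <= euclidean_norm x `^ (alpha - n%:R))%R.
  move=> /andP[jx xj]; apply: le_powR_neg => //; last exact: ltW.
  by rewrite (lt_le_trans _ jx)// exprn_gt0.
have uw j : u j <= (w j)%:E.
  rewrite /w sE /s; case: ltnP => jj0.
    apply: (@le_trans _ _ C%:E); last first.
      rewrite lee_fin mulr1 lerDl mulr_ge0//; first by rewrite divr_ge0// ltW.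
      by rewrite -lee_fin -nuL.
    have := capacity_annulus_le alpha halphan
      (dirac ((0%R : 'rV[R]_n) : borel R n))
      (A `&` annulus q 0 j) setT q 1 j q1 ltr01.
    rewrite /= diracT divr1 mule1; apply => //.
      by rewrite ltry.
    move=> x [_ +]; rewrite /annulus/= edistx0 => xj.
    rewrite integral_dirac//; last exact: measurable_kernelr.
    rewrite diracT mul1e mul1r.
    rewrite (le_trans _ (riesz_kernel_ge alpha halphan _ _ _ (lexx _)))//.
    by rewrite edistx0 lee_fin powx.
  have := capacity_annulus_le alpha halphan nu
      (A `&` annulus q 0 j) (L j) q delta%R j q1 d0 nuT (mL j).
  rewrite nuL -EFinM mulr0 add0r; apply => x [Ax +].
  rewrite /annulus/= edistx0 => xj.
  have X0 : (0 < euclidean_norm x)%R.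
    by case/andP : xj => + _; apply: lt_le_trans; rewrite exprn_gt0.
  have kX : (k%:R <= eps * euclidean_norm x)%R.
    rewrite mulrC -ler_pdivrMr// (le_trans (hj0 _ jj0))//.
    by case/andP : xj.
  apply: (le_trans _ (local_potential_ge mu nu (L j) x eps m m' k%:R _ X0 kX
    (mL j) nuE muB (fun y => LX x j y xj) (AP x Ax))); last by rewrite eps0.
  by rewrite lee_fin ler_pM2l// powx.
have sumw N : (\sum_(0 <= j < N) w j <=
    C * (j0%:R * 1) + C / delta * (l%:R * m))%R.
  rewrite /w big_split/= -!mulr_sumr lerD//.
    rewrite ler_wpM2l// sum_shift_le// => j.
    by rewrite /s; case: (j < j0)%N; rewrite ?lexx ?ler01.
  by rewrite ler_wpM2l ?divr_ge0 ?(ltW d0)// sum_shift_le.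
rewrite -/(u _).
apply: (@le_lt_trans _ _ (C * (j0%:R * 1) + C / delta * (l%:R * m))%:E); last first.
  exact: ltry.
apply: lime_le; first by apply: is_cvg_nneseries => *; exact: u0.
apply: nearW => N; apply: (@le_trans _ _ (\sum_(0 <= j < N) (w j)%:E)).
  by apply: lee_sum => j _; exact: uw.
by rewrite sumEFin lee_fin sumw.
Qed.

End thinness.

Theorem corollary1p8 (R : realType) (n : nat) (alpha : R)
  (hn : (2 <= n)%N) (halpha0 : 0 < alpha) (halpha2 : alpha <= 2)
  (halphan : alpha < n%:R)
  (xi : signed_radon R n) (xip xim : {measure set (borel R n) -> \bar R})
  (hxi : hahn_jordan xi xip xim) (hM : in_M alpha xip xim)
  (hmass : xip setT <> xim setT) :
  inner_thin_at_infinity alpha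
    [set x : 'rV[R]_n | signed_potential alpha xip xim x = 0%E].
Proof.
have zero x : signed_potential alpha xip xim x = 0%E ->
    potential alpha xip x = potential alpha xim x.
  rewrite /signed_potential; case: (potential alpha xip x) => [r||];
    case: (potential alpha xim x) => [r'||]//= [].
  by move=> /eqP; rewrite subr_eq0 => /eqP ->.
have [lt|gt|//] := ltgtP (xip setT) (xim setT).
- apply: (thin_at_infinity_of_mass_lt alpha halphan xim xip _ lt) => x /= /zero ->.
  exact: lexx.
- apply: (thin_at_infinity_of_mass_lt alpha halphan xip xim _ gt) => x /= /zero ->.
  exact: lexx.
Qed.
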